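(* (Type $q$-P$(A_4)$.) Let $Y(x)={}^t(y_1(x),y_2(x))$ be meromorphic on $\mathbb{C}^*$ and satisfy $Y(qx)=A(x)Y(x)$ with the matrix $A(x)$ of the context, and suppose $\lambda=a_3$. Then $$y_1(q^2x)-\{q^2\kappa_1x^2-dx+(\theta_1+\theta_2)t\}y_1(qx)+\kappa_1\kappa_2(qx-a_3)(x-a_1t)(x-a_2t)y_1(x)=0,$$ $$d=q\kappa_1a_3+\frac{q(\theta_1+\theta_2)t}{a_3}-\frac{(a_3-a_1t)(a_3-a_2t)}{\mu a_3}.$$ Moreover, if $u$ is a meromorphic function on $\mathbb{C}^*$, not identically zero, with $u(qx)=(x-a_1t)u(x)$, then $f(x)=y_1(qx)/u(qx)$ satisfies $$(qx-a_1t)f(qx)-\{q^2\kappa_1x^2-dx+(\theta_1+\theta_2)t\}f(x)+\kappa_1\kappa_2(qx-a_3)(x-a_2t)f(x/q)=0.$$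
   Context: Let $q,t,\kappa_1,\kappa_2,a_1,a_2,a_3,\theta_1,\theta_2,\lambda,\mu,\omega$ be nonzero complex numbers with $\theta_1\theta_2=-\kappa_1\kappa_2a_1a_2a_3$. The matrix is $$A(x)=\begin{pmatrix}\kappa_1\{(x-\lambda)(x-\alpha)+\mu_1\}&\omega(x-\lambda)\\ \kappa_1\omega^{-1}(\gamma x+\delta)&\kappa_2(x-\lambda)+\mu_2\end{pmatrix},$$ $$\mu_1=\frac{(\lambda-a_1t)(\lambda-a_2t)}{q\kappa_1\mu},\quad \mu_2=q\kappa_1\kappa_2\mu(\lambda-a_3),\quad \alpha=\frac{\lambda^{-1}\{(\theta_1+\theta_2)t-\kappa_1\mu_1-\mu_2\}+\kappa_2}{\kappa_1},$$ $$\gamma=\mu_2-\kappa_2\{2\lambda+\alpha-(a_1+a_2)t-a_3\},\quad \delta=-\lambda^{-1}\{\kappa_2a_1a_2a_3t^2-(\alpha\lambda+\mu_1)(\kappa_2\lambda-\mu_2)\}.$$ (This is the linear system of Murata's Lax form for the $q$-Painlevé equation of type $A_4$; it satisfies $\det A(x)=\kappa_1\kappa_2(x-a_1t)(x-a_2t)(x-a_3)$.) Equations are understood as identities of meromorphic functions. *)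

(* Defs.v *)
From HB Require Import structures.
From mathcomp Require Import all_boot all_order all_algebra.
From mathcomp Require Import complex.
From mathcomp Require Import all_classical all_reals all_analysis.

Set Implicit Arguments.
Unset Strict Implicit.
Unset Printing Implicit Defensive.

Import Order.TTheory GRing.Theory Num.Theory.
Import numFieldNormedType.Exports.

Local Open Scope classical_set_scope.
Local Open Scope ring_scope.

(* The complex numbers as a normed module over themselves: [derivable f z 1]
   for [f : Cplx R -> Cplx R] is complex differentiability at [z]. *)
Definition Cplx (R : realType) : normedModType R[i] := R[i]^o.

Definition holomorphic_at (R : realType) (f : Cplx R -> Cplx R) (z0 : R[i]) :=
  \forall z \near (z0 : Cplx R), derivable f z (1 : R[i]).

(* A meromorphic function is represented by a total function whose values at a
   discrete set of points (in particular at the poles) are irrelevant. *)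
Definition meromorphic_at (R : realType) (f : R[i] -> R[i]) (z0 : R[i]) :=
  exists (n : nat) (g : R[i] -> R[i]), holomorphic_at g z0 /\
    \forall z \near (z0 : Cplx R)^', f z = (z - z0) ^- n * g z.

Definition meromorphic_Cstar (R : realType) (f : R[i] -> R[i]) :=
  forall z0 : R[i], z0 != 0 -> meromorphic_at f z0.

(* Identity of meromorphic functions on C^*: equality of values off a subset
   of C^* without accumulation point in C^*. *)
Definition eq_mero (R : realType) (T : Type) (f g : R[i] -> T) :=
  forall z0 : R[i], z0 != 0 -> \forall z \near (z0 : Cplx R)^', f z = g z.

Definition mx22 (K : Type) (a b c d : K) : 'M[K]_2 :=
  \matrix_(i < 2, j < 2)
    if i == 0 then (if j == 0 then a else b) else (if j == 0 then c else d).

Definition murata_mx (K : fieldType)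
    (q t kappa1 kappa2 a1 a2 a3 theta1 theta2 lambda mu omega x : K) : 'M[K]_2 :=
  let mu1 := (lambda - a1 * t) * (lambda - a2 * t) / (q * kappa1 * mu) in
  let mu2 := q * kappa1 * kappa2 * mu * (lambda - a3) in
  let alpha := (lambda^-1 * ((theta1 + theta2) * t - kappa1 * mu1 - mu2)
                + kappa2) / kappa1 in
  let gamma := mu2
      - kappa2 * (2 * lambda + alpha - (a1 + a2) * t - a3) in
  let delta := - (lambda^-1 * (kappa2 * a1 * a2 * a3 * t ^+ 2
      - (alpha * lambda + mu1) * (kappa2 * lambda - mu2))) in
  mx22 (kappa1 * ((x - lambda) * (x - alpha) + mu1))
       (omega * (x - lambda))
       (kappa1 * omega^-1 * (gamma * x + delta))
       (kappa2 * (x - lambda) + mu2).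

(* Main.v *)
Require Import Defs.
From HB Require Import structures.
From mathcomp Require Import all_boot all_order all_algebra.
From mathcomp Require Import complex.
From mathcomp Require Import all_classical all_reals all_analysis.
From mathcomp Require Import ring.

Set Implicit Arguments.
Unset Strict Implicit.
Unset Printing Implicit Defensive.

Import Order.TTheory GRing.Theory Num.Theory.
Import numFieldNormedType.Exports.

Local Open Scope ring_scope.

(** With [lambda = a3] the second column of the matrix is [x - a3] times the
    constant vector [(omega, kappa2)], so that [y2] can be eliminated without
    dividing by [x - a3]. The equation for [f] is the one for [y1] divided by
    [u(qx)]. Zeros of [u] need no separate treatment: since [x / 0 = 0] and
    [u(qx) = (x - a1 t) u(x)], at a zero of [u(qx)] with [x] and [qx] different
    from [a1 t] all three values of [f] vanish. *)

Lemma dnbhs_neq (K : numFieldType) (V : normedModType K) (z0 c : V) :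
  \forall z \near z0^'%classic, z != c.
Proof.
have [->|z0c] := eqVneq z0 c; first exact: nbhs_dnbhs_neq.
apply: nbhs_dnbhs; have : nbhs z0 (~` [set c])%classic.
  apply: open_nbhs_nbhs; split; last exact/eqP.
  apply: closed_openC; apply: accessible_closed_set1.
  exact/hausdorff_accessible/norm_hausdorff.
by apply: filterS => z /eqP.
Qed.

(** Scaling is continuous, and injectivity for [c != 0] keeps the centre out of the image of a
    punctured neighbourhood. *)
Lemma near_dnbhs_scale (K : numFieldType) (V : normedModType K) (c : K)
    (z0 : V) (P : V -> Prop) : c != 0 ->
  (\forall z \near (c *: z0)^'%classic, P z) -> \forall z \near z0^'%classic, P (c *: z).
Proof.
move=> c0; rewrite /dnbhs !near_withinE => cP.
have /= := @scaler_continuous K V c z0 _ cP.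
rewrite !near_simpl; apply: filterS => z /= Hz zz0; apply: Hz.
by apply: contra_neq zz0 => /(scalerI c0).
Qed.

Lemma eq_mero_dilation (R : realType) (T : Type) (f g : R[i] -> T) (c : R[i]) :
  c != 0 -> eq_mero f g -> eq_mero (fun x => f (c * x)) (fun x => g (c * x)).
Proof.
move=> c0 fg z0 z00.
have cz0 : c * z0 != 0 by rewrite mulf_neq0.
exact: (@near_dnbhs_scale _ (Cplx R) c z0 (fun z => f z = g z) c0 (fg _ cz0)).
Qed.

(** Pointwise form of the elimination: [Y0], [Y1], [Y2] stand for the values at x, qx, q^2 x.
    Substituting omega (x - a3) y2(x) = y1(qx) - A11(x) y1(x) into y1(q^2 x) makes the coefficient
    of y1(qx) the trace of A(qx), and that of y1(x) becomes -(qx - a3) det A(x) / (x - a3), which is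
    polynomial in x. *)
Lemma murata_mx_elim (K : fieldType)
    (q t kappa1 kappa2 a1 a2 a3 theta1 theta2 mu omega x : K)
    (Y0 Y1 Y2 : 'cV[K]_2) :
  q != 0 -> kappa1 != 0 -> a3 != 0 -> mu != 0 -> omega != 0 ->
  let A := murata_mx q t kappa1 kappa2 a1 a2 a3 theta1 theta2 a3 mu omega in
  Y1 = A x *m Y0 -> Y2 = A (q * x) *m Y1 ->
  Y2 0 0 - (q ^+ 2 * kappa1 * x ^+ 2
            - (q * kappa1 * a3 + q * (theta1 + theta2) * t / a3
               - (a3 - a1 * t) * (a3 - a2 * t) / (mu * a3)) * x
            + (theta1 + theta2) * t) * Y1 0 0
  + kappa1 * kappa2 * (q * x - a3) * (x - a1 * t) * (x - a2 * t) * Y0 0 0 = 0.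
Proof.
move=> q0 k0 a0 m0 w0 /= -> ->.
rewrite /murata_mx !mxE !big_ord_recr !big_ord0 /= !mxE.
rewrite !big_ord_recr !big_ord0 /= !mxE /=.
(* Unfolding the sums writes the first index in this form; it must become [0] for [field] to
   recognise the entries in the goal. *)
have -> : widen_ord (leqnSn 1) ord_max = 0 :> 'I_2 by exact: val_inj.
field.
by rewrite q0 k0 a0 m0 w0.
Qed.

Theorem mainTheorem3 (R : realType)
    (q t kappa1 kappa2 a1 a2 a3 theta1 theta2 lambda mu omega : R[i])
    (q_neq0 : q != 0) (t_neq0 : t != 0)
    (kappa1_neq0 : kappa1 != 0) (kappa2_neq0 : kappa2 != 0)
    (a1_neq0 : a1 != 0) (a2_neq0 : a2 != 0) (a3_neq0 : a3 != 0)
    (theta1_neq0 : theta1 != 0) (theta2_neq0 : theta2 != 0)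
    (lambda_neq0 : lambda != 0) (mu_neq0 : mu != 0) (omega_neq0 : omega != 0)
    (theta_rel : theta1 * theta2 = - (kappa1 * kappa2 * a1 * a2 * a3))
    (Y : R[i] -> 'cV[R[i]]_2)
    (Y_mero : forall i : 'I_2, meromorphic_Cstar (fun x => Y x i 0))
    (Y_eq : eq_mero (fun x => Y (q * x))
       (fun x => murata_mx q t kappa1 kappa2 a1 a2 a3 theta1 theta2
                   lambda mu omega x *m Y x))
    (lambda_a3 : lambda = a3) :
  let y1 : R[i] -> R[i] := fun x => Y x 0 0 in
  let d : R[i] := q * kappa1 * a3 + q * (theta1 + theta2) * t / a3
           - (a3 - a1 * t) * (a3 - a2 * t) / (mu * a3) in
  eq_mero
    (fun x => y1 (q ^+ 2 * x)
       - (q ^+ 2 * kappa1 * x ^+ 2 - d * x + (theta1 + theta2) * t) * y1 (q * x)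
       + kappa1 * kappa2 * (q * x - a3) * (x - a1 * t) * (x - a2 * t) * y1 x)
    (fun=> 0)
  /\
  (forall u : R[i] -> R[i],
     meromorphic_Cstar u ->
     ~ eq_mero u (fun=> 0) ->
     eq_mero (fun x => u (q * x)) (fun x => (x - a1 * t) * u x) ->
     let f : R[i] -> R[i] := fun x => y1 (q * x) / u (q * x) in
     eq_mero
       (fun x => (q * x - a1 * t) * f (q * x)
          - (q ^+ 2 * kappa1 * x ^+ 2 - d * x + (theta1 + theta2) * t) * f x
          + kappa1 * kappa2 * (q * x - a3) * (x - a2 * t) * f (x / q))
       (fun=> 0)).
Proof.
move=> y1 d.
(* The system with x replaced by qx gives Y(q^2 x) = A(qx) Y(qx). *)
have Y_eq2 := eq_mero_dilation q_neq0 Y_eq.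
have y1_eq : eq_mero
    (fun x => y1 (q ^+ 2 * x)
       - (q ^+ 2 * kappa1 * x ^+ 2 - d * x + (theta1 + theta2) * t) * y1 (q * x)
       + kappa1 * kappa2 * (q * x - a3) * (x - a1 * t) * (x - a2 * t) * y1 x)
    (fun=> 0).
  move=> z0 z00; move: (Y_eq _ z00) (Y_eq2 _ z00); apply: filterS2 => x Y1 Y2.
  move: Y1 Y2; rewrite lambda_a3 mulrA -expr2 => Y1 Y2.
  exact: murata_mx_elim Y1 Y2.
split=> // u _ _ u_eq f z0 z00.
have u_eq2 := eq_mero_dilation q_neq0 u_eq.
near=> x.
(* Away from a1 t and a1 t / q, the values u(qx) and u(q^2 x) vanish only if u(x) does. *)
have xa : x - a1 * t != 0.
  by rewrite subr_eq0; near: x; exact: (@dnbhs_neq _ (Cplx R)).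
have qxa : q * x - a1 * t != 0.
  have : x != a1 * t / q by near: x; exact: (@dnbhs_neq _ (Cplx R)).
  by apply: contra_neq => /subr0_eq <-; rewrite mulrAC divff ?mul1r.
have ux : u (q * x) = (x - a1 * t) * u x by near: x; exact: u_eq.
have uqx : u (q * (q * x)) = (q * x - a1 * t) * u (q * x).
  by near: x; exact: u_eq2.
have qxq : q * (x / q) = x by rewrite mulrCA divff ?mulr1.
have q2x : q * (q * x) = q ^+ 2 * x by rewrite expr2 mulrA.
rewrite /f qxq uqx ux q2x.
have [->|ux0] := eqVneq (u x) 0; first by rewrite !mulr0 invr0; ring.
(* The factor inverted here is u(qx). The right side becomes the equation for [y1] divided by it,
   where (qx - a1 t) f(qx) = y1(q^2 x) / u(qx) and f(x/q) = (x - a1 t) y1(x) / u(qx). *)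
rewrite -[RHS](mul0r ((x - a1 * t) * u x)^-1).
have <- : y1 (q ^+ 2 * x)
    - (q ^+ 2 * kappa1 * x ^+ 2 - d * x + (theta1 + theta2) * t) * y1 (q * x)
    + kappa1 * kappa2 * (q * x - a3) * (x - a1 * t) * (x - a2 * t) * y1 x = 0.
  by near: x; exact: y1_eq.
field.
by rewrite ux0 xa qxa.
Unshelve. all: by end_near.
Qed.
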